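(* Let $n \ge 2$ and $k$ be positive integers with $k \le \lceil \frac{n}{2} \rceil$. Let $S = \{s_1, s_2, \ldots, s_k\}$ be a subset of $[n]$ with $s_1 < s_2 < \cdots < s_k$. Then $S$ is a pinnacle set of the path graph $P_n$ on $n$ vertices if and only if $\ell(s_i) \ge i$ for all $1 \le i \le k-1$ and $s_k = n$.
   Context: Graphs are finite and simple, and $[n] = \{1,2,\ldots,n\}$. A labeling of a graph $G$ with $n$ vertices is a bijection $\lambda : V(G) \to [n]$. The label $\lambda(u)$ of a vertex $u$ is a pinnacle of $(G,\lambda)$ if $\lambda(u) > \lambda(v)$ for every neighbor $v$ of $u$ (in particular, labels of leaves may be pinnacles). The pinnacle set of $(G,\lambda)$ is the set of all pinnacles of $(G,\lambda)$. A subset $S \subseteq [n]$ is a pinnacle set of $G$ if there is a labeling $\lambda$ of $G$ such that $S$ is the pinnacle set of $(G,\lambda)$. For $S = \{s_1,\ldots,s_k\} \subseteq [n]$, define $\ell(s_i) = |\{x \in [n]\setminus S : x < s_i\}|$, the number of elements of $[n]$ that are less than $s_i$ and are not in $S$. *)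

(* Defs.v *)
From mathcomp Require Import all_boot.

Set Implicit Arguments.
Unset Strict Implicit.
Unset Printing Implicit Defensive.

Record sgraph := SGraph {
  vertex :> finType;
  adj : rel vertex;
  adj_sym : symmetric adj;
  adj_irrefl : irreflexive adj }.

(* The set [n] = {1, ..., n}, as a finite type. *)
Definition label (n : nat) := {x : 'I_n.+1 | 0 < x}.

Definition nat_of_label (n : nat) (x : label n) : nat := val (val x).
Coercion nat_of_label : label >-> nat.

Section Pinnacles.
Variables (G : sgraph) (n : nat).
Implicit Types (lam : G -> label n) (S : {set label n}).

(* Since #|label n| = n, a labeling exists only when G has n vertices; n is
   a separate parameter because #|'I_n| is not convertible to n. *)
Definition labeling lam : Prop := bijective lam.

Definition is_pinnacle lam (u : G) : bool :=
  [forall v, adj u v ==> (lam v < lam u)].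

Definition pinnacles lam : {set label n} :=
  [set lam u | u : G & is_pinnacle lam u].

Definition pinnacle_set S : Prop :=
  exists lam, labeling lam /\ pinnacles lam = S.

End Pinnacles.

Definition ell (n : nat) (S : {set label n}) (s : label n) : nat :=
  #|[set x : label n in ~: S | x < s]|.

Definition path_adj (n : nat) : rel 'I_n :=
  fun i j => (i.+1 == j :> nat) || (j.+1 == i :> nat).

Lemma path_adj_sym (n : nat) : symmetric (@path_adj n).
Proof. by move=> i j; rewrite /path_adj orbC. Qed.

Lemma path_adj_irrefl (n : nat) : irreflexive (@path_adj n).
Proof. by move=> i; rewrite /path_adj orbb -[X in _ == X]addn0 -addn1 eqn_add2l. Qed.

Definition path_graph (n : nat) : sgraph :=
  SGraph (@path_adj_sym n) (@path_adj_irrefl n).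

(* Main.v *)
Require Import Defs.
From mathcomp Require Import all_boot.
From mathcomp Require Import zify.

(** Necessity.  The largest label [n] is always a pinnacle, so it is the last
    element of [S]; let [q] be the vertex carrying it.  To every pinnacle
    smaller than [n] attach the neighbour of its vertex on the side of [q].
    The label of that neighbour is smaller, and it is not a pinnacle because a
    neighbour of a pinnacle never is one.  Different pinnacles get different
    neighbours: two pinnacles on the same side of [q] are both shifted by one,
    and two pinnacles on opposite sides could only collide at [q] itself, which
    is excluded because [q] is a pinnacle.  So below a label [y < n] there are at
    least as many non-pinnacles as there are pinnacles up to [y]
    ([leq_card_pinnacles_ell]); for [y = s i] this is [i <= ell S (s i)].

    Sufficiency.  Let [t_1 < t_2 < ...] be the labels outside [S].  The bound
    [i <= ell S (s_i)] says exactly that [t_i < s_i], and [k <= uphalf n] that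
    there are at least [k - 1] of the [t_j].  Read along the path the
    labeling
      [s_1 t_1 s_2 t_2 ... s_(k-1) t_(k-1) t_k t_(k+1) ... t_(n-k) s_k].
    Every [s_i] with [i < k] exceeds [t_i], and also [t_(i-1)] since
    [t_(i-1) < s_(i-1) < s_i]; the final [s_k = n] exceeds everything; and
    every [t_j] has a larger label next to it, namely [s_j] if [j < k] and the
    next label if [j >= k].  The pinnacle set is therefore [S]
    ([zigzag_pinnacle_set]). *)

Set Implicit Arguments.
Unset Strict Implicit.
Unset Printing Implicit Defensive.

(** * Labels, and pinnacles of an arbitrary graph *)

Lemma nat_of_label_inj n : injective (@nat_of_label n).
Proof. by move=> x y e; apply/val_inj/val_inj. Qed.

Lemma label_leq n (x : label n) : x <= n.
Proof. by rewrite -ltnS; apply: ltn_ord. Qed.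

Lemma label_max_exists n : 0 < n -> exists x : label n, x = n :> nat.
Proof.
by move=> n_gt0; exists (exist (fun x : 'I_n.+1 => 0 < x) ord_max n_gt0).
Qed.

Lemma card_label n : #|{: label n}| = n.
Proof.
rewrite card_sig -[RHS]/(n.+1.-1) -[X in X.-1]card_ord -(cardC1 (@ord0 n)).
by apply: eq_card => x; rewrite !inE -val_eqE lt0n.
Qed.

Lemma is_pinnacle_lt (G : sgraph) n (lam : G -> label n) u v :
  is_pinnacle lam u -> adj u v -> lam v < lam u.
Proof. by move=> /forallP/(_ v)/implyP. Qed.

Lemma max_is_pinnacle (G : sgraph) n (lam : G -> label n) u :
  injective lam -> lam u = n :> nat -> is_pinnacle lam u.
Proof.
move=> lam_inj lamu; apply/forallP => v; apply/implyP => uv.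
rewrite ltn_neqAle {2}lamu label_leq andbT.
by apply: contraL uv => /eqP/nat_of_label_inj/lam_inj->; rewrite adj_irrefl.
Qed.

Lemma mem_pinnacles (G : sgraph) n (lam : G -> label n) u :
  injective lam -> (lam u \in pinnacles lam) = is_pinnacle lam u.
Proof. by move=> lam_inj; rewrite mem_imset // inE. Qed.

Lemma neighbour_notin_pinnacles (G : sgraph) n (lam : G -> label n) u v :
  injective lam -> is_pinnacle lam u -> adj u v -> lam v \notin pinnacles lam.
Proof.
move=> lam_inj uP uv; rewrite mem_pinnacles //; apply/negP => vP.
have := is_pinnacle_lt uP uv.
by rewrite ltnNge ltnW // (is_pinnacle_lt vP) // adj_sym.
Qed.

(** * Pinnacles on a path: the counting bound *)

(** On a path the positions are numbers, and this is the neighbour of [p] on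
    the side of [q] as long as [p] differs from [q]. *)
Definition step_towards (q p : nat) := if p < q then p.+1 else p.-1.

Lemma step_towards_ltn n q p : q < n -> p < n -> step_towards q p < n.
Proof. by rewrite /step_towards => q_lt p_lt; case: (ltnP p q); lia. Qed.

(** The last two disequalities exclude the only possible collision, that of
    [q.-1] and [q.+1] both moving to [q]. *)
Lemma step_towards_inj q p p' :
  p != q -> p' != q -> step_towards q p != q -> step_towards q p' != q ->
  step_towards q p = step_towards q p' -> p = p'.
Proof.
by move=> pq p'q; rewrite /step_towards; case: (ltnP p q); case: (ltnP p' q); lia.
Qed.

(** Moving from each pinnacle one step towards the vertex labeled [n] is an
    injection from the pinnacles up to [y] into the non-pinnacles below [y].
    The assumption [y < n] keeps the vertex labeled [n], which has no such
    step, out of the domain. *)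
Lemma leq_card_pinnacles_ell n (lam : path_graph n -> label n) (y : label n) :
  labeling lam -> y < n ->
  #|[set x : label n in pinnacles lam | x <= y]| <= ell (pinnacles lam) y.
Proof.
move=> lam_bij y_lt; have lam_inj := bij_inj lam_bij.
have [z zE] : exists z : label n, z = n :> nat by apply: label_max_exists; lia.
have [pos posK lamK] := lam_bij.
pose q : 'I_n := pos z.
have qE : lam q = n :> nat by rewrite lamK.
have q_pin : is_pinnacle lam q by apply: max_is_pinnacle.
pose step (p : 'I_n) : 'I_n :=
  Ordinal (step_towards_ltn (ltn_ord q) (ltn_ord p)).
pose A := [set x : label n in pinnacles lam | x <= y].
have A_pin x : x \in A -> is_pinnacle lam (pos x).
  by rewrite inE => /andP[]; rewrite -{1}(lamK x) mem_pinnacles.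
have A_neq x : x \in A -> (pos x : 'I_n) != q :> nat.
  rewrite inE => /andP[_ xy]; apply/eqP => /val_inj e.
  by move: xy; rewrite -(lamK x) e qE leqNgt y_lt.
have A_adj x : x \in A -> adj (pos x : path_graph n) (step (pos x)).
  by move=> /A_neq; rewrite /= /path_adj /= /step_towards; case: ltnP; lia.
(* A neighbour of a pinnacle is not a pinnacle, whereas [q] is one. *)
have step_neq x : x \in A -> step (pos x) != q :> nat.
  move=> xA; apply/eqP => /val_inj e.
  have := neighbour_notin_pinnacles lam_inj (A_pin _ xA) (A_adj _ xA).
  by rewrite e mem_pinnacles // q_pin.
have step_inj : {in A &, injective (fun x => lam (step (pos x)))}.
  move=> x x' xA xA' /lam_inj/(congr1 val) /= e.
  apply: (can_inj lamK); apply: val_inj.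
  move: (A_neq _ xA) (A_neq _ xA') (step_neq _ xA) (step_neq _ xA') e.
  exact: step_towards_inj.
rewrite -/A -(card_in_imset step_inj) /ell; apply/subset_leq_card/subsetP.
move=> _ /imsetP[x xA ->].
rewrite !inE (neighbour_notin_pinnacles lam_inj (A_pin _ xA) (A_adj _ xA)) /=.
apply: leq_trans (is_pinnacle_lt (A_pin _ xA) (A_adj _ xA)) _.
by rewrite lamK; move: xA; rewrite inE => /andP[].
Qed.

(** * Finite enumerations and bijections *)

(** The default [x0] serves the indices beyond [#|A|]; the type [label 0] is
    empty, so there is no canonical one. *)
Lemma increasing_enum n (A : {set label n}) (x0 : label n) :
  exists t : nat -> label n,
  [/\ forall i, i < #|A| -> t i \in A,
      forall i j, i < j -> j < #|A| -> t i < t j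
    & forall x, x \in A -> exists2 i, i < #|A| & x = t i].
Proof.
pose r : rel (label n) := relpre (@nat_of_label n) leq.
pose e := sort r (enum A).
have r_tr : transitive r by move=> y x z; apply: leq_trans.
have e_sorted : sorted r e by apply: sort_sorted => x y; apply: leq_total.
have e_size : size e = #|A| by rewrite size_sort cardE.
have e_mem x : (x \in e) = (x \in A) by rewrite mem_sort mem_enum.
have e_uniq : uniq e by rewrite sort_uniq enum_uniq.
exists (nth x0 e); split=> [i iA|i j ij jA|x xA].
- by rewrite -e_mem mem_nth ?e_size.
- rewrite ltn_neqAle (inj_eq (@nat_of_label_inj n)) nth_uniq ?e_size //; last lia.
  rewrite (ltn_eqF ij) /=.
  by apply: (sorted_ltn_nth r_tr) => //; rewrite inE e_size //; lia.
- exists (index x e); first by rewrite -e_size index_mem e_mem.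
  by rewrite nth_index ?e_mem.
Qed.

(** If [y <= t i], the elements of [A] below [y] are among [t 0], ..., [t i.-1],
    so there are at most [i] of them. *)
Lemma ltn_of_ltn_card n (A : {set label n}) (t : nat -> label n) (y : label n) i :
  (forall j l, j < l -> l < #|A| -> t j < t l) ->
  (forall x, x \in A -> exists2 j, j < #|A| & x = t j) ->
  i < #|[set x : label n in A | x < y]| -> t i < y.
Proof.
move=> t_incr t_surj i_lt; rewrite ltnNge; apply/negP => y_le.
move: i_lt; rewrite ltnNge => /negP; apply.
rewrite -[X in _ <= X]card_ord.
apply: leq_trans (leq_imset_card (fun j : 'I_i => t j) _).
apply/subset_leq_card/subsetP => x; rewrite inE => /andP[/t_surj[j jA ->] jy].
have ji : j < i.
  rewrite ltnNge leq_eqVlt; apply/negP => /orP[/eqP ij|ij].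
    by move: jy; rewrite -ij ltnNge y_le.
  by have := t_incr _ _ ij jA; lia.
by apply/imsetP; exists (Ordinal ji).
Qed.

Lemma surj_bij (T T' : finType) (f : T -> T') :
  #|T| = #|T'| -> (forall y, exists x, f x = y) -> bijective f.
Proof.
move=> cardT /fin_all_exists[g fgK].
have g_bij : bijective g by apply: inj_card_bij (can_inj fgK) _; rewrite cardT.
exact: bij_can_bij g_bij _ fgK.
Qed.

(** * The zigzag labeling *)

Section Zigzag.

Variables (n m : nat) (s t : nat -> label n).

(** Positions and both enumerations start at 0 here, so [m] is [k - 1] and the
    word is [s 0, t 0, ..., s m.-1, t m.-1, t m, t m.+1, ..., s m], where the
    last letter sits at position [n.-1]. *)
Definition zigzag (p : nat) : label n :=
  if p < m.*2 then if odd p then t p./2 else s p./2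
  else if p.+1 == n then s m else t (p - m).

(** The positions of [s 0], ..., [s m.-1]; by [zigzag_ltn] these are exactly the
    positions followed by a smaller label. *)
Definition zigzag_desc (p : nat) := (p < m.*2) && ~~ odd p.

Variable S : {set label n}.
Hypothesis n_gt1 : 1 < n.
Hypothesis m2_lt : m.*2 < n.
Hypothesis s_in : forall i, i <= m -> s i \in S.
Hypothesis s_surj : forall x, x \in S -> exists2 i, i <= m & x = s i.
Hypothesis s_incr : forall i j, i < j -> j <= m -> s i < s j.
Hypothesis s_max : s m = n :> nat.
Hypothesis t_notin : forall i, i + m.+1 < n -> t i \notin S.
Hypothesis t_surj :
  forall x, x \notin S -> exists2 i, i + m.+1 < n & x = t i.
Hypothesis t_incr : forall i j, i < j -> j + m.+1 < n -> t i < t j.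
Hypothesis t_lt_s : forall i, i < m -> t i < s i.

Lemma t_lt_max i : i + m.+1 < n -> t i < s m.
Proof.
move=> i_lt; rewrite ltn_neqAle {2}s_max label_leq andbT.
rewrite (inj_eq (@nat_of_label_inj n)).
by apply: contraNneq (t_notin i_lt) => ->; apply: s_in.
Qed.

Lemma zigzag_in p : p < n -> (zigzag p \in S) = zigzag_desc p || (p.+1 == n).
Proof.
move=> p_lt; rewrite /zigzag /zigzag_desc; case: ifP => p_m /=.
  case: ifP => p_odd /=; last by rewrite s_in //; lia.
  by rewrite (negPf (t_notin _)); lia.
by case: eqP => [_|p_n]; [rewrite s_in|rewrite (negPf (t_notin _)) //; lia].
Qed.

Lemma zigzag_ltn p : p.+1 < n ->
  if zigzag_desc p then zigzag p.+1 < zigzag p else zigzag p < zigzag p.+1.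
Proof.
move=> p_lt; rewrite /zigzag /zigzag_desc.
case: (ltnP p m.*2) => p_m /=; last first.
  have -> : (p.+1 == n) = false by lia.
  have -> : (p.+1 < m.*2) = false by lia.
  by case: (p.+2 =P n) => p_n; [apply: t_lt_max|apply: t_incr]; lia.
have [p_odd|p_even] := boolP (odd p); last first.
  rewrite ifT /= ?p_even; last lia.
  have -> : uphalf p = p./2 by lia.
  by apply: t_lt_s; lia.
rewrite /=; case: ifP => p1_m.
  apply: ltn_trans (_ : s p./2 < _); first by apply: t_lt_s; lia.
  by apply: s_incr; lia.
by case: (p.+2 =P n) => p_n; [apply: t_lt_max|apply: t_incr]; lia.
Qed.

(** A position carries a pinnacle when the word does not descend into it from
    the left and does not ascend out of it on the right.  The labels of [S] are
    at the descents, no two of which are consecutive, and at the last position,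
    which is not preceded by a descent because a descent is followed by some
    [t i]. *)
Lemma zigzag_pinnacle (p : path_graph n) :
  is_pinnacle (fun u : path_graph n => zigzag (u : 'I_n)) p
    = (zigzag (p : 'I_n) \in S).
Proof.
have p_lt := ltn_ord p; rewrite zigzag_in //; apply/idP/idP => [p_pin|p_top].
  apply/orP; case: (eqVneq (p : 'I_n).+1 n) => [|p_n]; [by right|left].
  have p1_lt : (p : 'I_n).+1 < n by lia.
  have := zigzag_ltn p1_lt; case: ifP => // _.
  have := @is_pinnacle_lt (path_graph n) _ _ _ (Ordinal p1_lt) p_pin.
  by rewrite /= /path_adj /= eqxx => /(_ isT); lia.
apply/forallP => v; apply/implyP => /orP[]/eqP pv; have v_lt := ltn_ord v.
  have := @zigzag_ltn (p : 'I_n); rewrite pv => /(_ v_lt).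
  by case: ifP => // p_desc; move: p_top; rewrite p_desc; lia.
have := @zigzag_ltn (v : 'I_n); rewrite pv => /(_ p_lt).
by case: ifP => // v_desc; move: p_top v_desc; rewrite /zigzag_desc; lia.
Qed.

Lemma zigzag_surj x : exists p : 'I_n, zigzag p = x.
Proof.
suff [p p_lt <-] : exists2 p, p < n & zigzag p = x by exists (Ordinal p_lt).
case: (boolP (x \in S)) => [/s_surj|/t_surj] [i i_lt ->]; rewrite /zigzag.
  case: (ltnP i m) => i_m.
    exists i.*2; first by lia.
    by rewrite ltn_double i_m odd_double doubleK.
  exists n.-1; first by lia.
  by rewrite ifF ?ifT; try lia; congr s; lia.
case: (ltnP i m) => i_m.
  exists i.*2.+1; first by lia.
  by rewrite ifT ?ifT; try lia; congr t; lia.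
exists (i + m); first by lia.
by rewrite ifF ?ifF; try lia; congr t; lia.
Qed.

Lemma zigzag_pinnacle_set : pinnacle_set (path_graph n) S.
Proof.
exists (fun u : path_graph n => zigzag (u : 'I_n)); split.
  by apply: surj_bij zigzag_surj; rewrite card_ord card_label.
apply/setP => x; apply/imsetP/idP => [[u]|xS].
  by rewrite inE zigzag_pinnacle => uS ->.
have [p pE] := zigzag_surj x.
by exists (p : path_graph n); rewrite ?inE ?zigzag_pinnacle pE.
Qed.

End Zigzag.

Theorem theorem3p9 (n k : nat) (hn : 2 <= n) (hk : 0 < k)
    (hkn : k <= uphalf n)
    (S : {set label n}) (s : nat -> label n)
    (hS : forall x : label n,
        x \in S <-> exists2 i : nat, 1 <= i <= k & x = s i)
    (hs : forall i j : nat, 1 <= i -> i < j -> j <= k -> s i < s j) :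
  pinnacle_set (path_graph n) S <->
  (forall i : nat, 1 <= i <= k - 1 -> i <= ell S (s i)) /\
  nat_of_label (s k) = n.
Proof.
have s_in i : 1 <= i <= k -> s i \in S by move=> ik; apply/hS; exists i.
have s_inj i j : 1 <= i <= k -> 1 <= j <= k -> s i = s j -> i = j.
  move=> ik jk e; case: (ltngtP i j) => // ij; exfalso.
    by have := @hs i j; rewrite e; lia.
  by have := @hs j i; rewrite e; lia.
have s_ord_inj i : i <= k -> injective (fun j : 'I_i => s j.+1).
  move=> ik j l /s_inj e; apply: val_inj => /=.
  by have := ltn_ord j; have := ltn_ord l; lia.
have card_below i : i <= k -> i <= #|[set x : label n in S | x <= s i]|.
  move=> ik; rewrite -{1}[i]card_ord -cardsT -(card_imset _ (s_ord_inj _ ik)).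
  apply/subset_leq_card/subsetP => _ /imsetP[j _ ->]; have ji := ltn_ord j.
  rewrite inE s_in /=; last lia.
  by case: (eqVneq j.+1 i) => [->//|ji']; apply/ltnW/hs; lia.
split=> [[lam [lam_bij lamS]]|[s_ell s_max]].
  have sk : s k = n :> nat.
    have [z zE] : exists z : label n, z = n :> nat.
      by apply: label_max_exists; lia.
    have [pos posK lamK] := lam_bij.
    have /hS[j jk zj] : z \in S.
      rewrite -lamS -(lamK z) mem_pinnacles ?max_is_pinnacle ?lamK //;
        exact: bij_inj.
    have := label_leq (s k); have := @hs j k; rewrite -zj zE.
    by case: (eqVneq j k) => [<-|]; [rewrite -zj|lia].
  split=> // i ik; apply: leq_trans (card_below i _) _; first by lia.
  rewrite -lamS; apply: leq_card_pinnacles_ell => //.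
  by rewrite -[X in _ < X]sk; apply: hs; lia.
have card_S : #|S| = k.
  rewrite -[RHS]card_ord -cardsT -(card_imset _ (s_ord_inj _ (leqnn k))).
  apply: eq_card => x; apply/idP/imsetP => [/hS[[//|i] ik ->]|[j _ ->]].
    by exists (Ordinal (ik : i < k)).
  by apply: s_in; have := ltn_ord j; lia.
have card_T : #|~: S| = n - k by rewrite cardsCs setCK card_label card_S.
have [t [t_in t_incr t_surj]] := increasing_enum (~: S) (s k).
(* [s] is indexed from 1, whereas [zigzag] reads both enumerations from 0. *)
apply: (@zigzag_pinnacle_set n k.-1 (fun i => s i.+1) t) => //.
- lia.
- by move=> i ik; apply: s_in; lia.
- by move=> x /hS[[//|i] ik ->]; exists i => //; lia.
- by move=> i j ij jk; apply: hs; lia.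
- by rewrite prednK.
- by move=> i ik; rewrite -in_setC; apply: t_in; lia.
- by move=> x; rewrite -in_setC => /t_surj[i ik ->]; exists i => //; lia.
- by move=> i j ij jk; apply: t_incr; lia.
move=> i ik; apply: (ltn_of_ltn_card t_incr t_surj).
by apply: s_ell; lia.
Qed.
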